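(* Let $G$ be a connected graph on $n$ vertices whose edge weights are $s\times s$ positive definite matrices, with Laplacian $L$ and resistance matrix $R$. Let $\tau$ be the $ns\times s$ matrix whose $i$-th $s\times s$ block is $\tau_i=2I_s-\sum_{j\sim i}W_{i,j}^{-1}R_{j,i}$. Then $$\det R=(-1)^{(n-1)s}\,2^{(n-3)s}\,\frac{\det(\tau'R\tau)}{\chi(G)},$$ where $\chi(G)$ is the cofactor in $L$ of any $s\times s$ block of $L$ (all such cofactors are equal).
   Context: $G$ is a simple connected graph with vertex set $\{1,\dots,n\}$; each edge $\{i,j\}$ carries a weight $W_{i,j}=W_{j,i}$, a real $s\times s$ positive definite matrix; $j\sim i$ means adjacency. The Laplacian $L$ is the $ns\times ns$ block matrix with $(i,i)$ block $\sum_{j\sim i}W_{i,j}^{-1}$, $(i,j)$ block ($i\ne j$) equal to $-W_{i,j}^{-1}$ if $i\sim j$ and $0$ otherwise. Writing $K_{i,j}$ for the $s\times s$ blocks of the Moore--Penrose inverse $L^\dagger$, the resistance matrix $R$ is the $ns\times ns$ block matrix with blocks $R_{i,j}=K_{i,i}+K_{j,j}-2K_{i,j}$. For an $N\times N$ matrix $A$, $S=\{i_1,\dots,i_k\}$, $K=\{j_1,\dots,j_k\}$, the cofactor of the submatrix $A[S,K]$ is $(-1)^{i_1+\cdots+i_k+j_1+\cdots+j_k}\det A(S,K)$, where $A(S,K)$ is $A$ with rows in $S$ and columns in $K$ deleted; the cofactor of the $(i,j)$ block of $L$ is the cofactor of the submatrix with row indices $\{(i-1)s+1,\dots,is\}$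 and column indices $\{(j-1)s+1,\dots,js\}$. *)

(* Defs.v *)
From mathcomp Require Import all_boot all_order all_algebra.
From mathcomp Require Import boolp classical_sets reals.

Set Implicit Arguments.
Unset Strict Implicit.
Unset Printing Implicit Defensive.

Import Order.TTheory GRing.Theory Num.Theory.

Local Open Scope ring_scope.

Definition posdef (R : realType) s (A : 'M[R]_s) : Prop :=
  A^T = A /\ forall x : 'cV[R]_s, x != 0 -> 0 < (x^T *m A *m x) 0 0.

(* The four Penrose equations; over the reals the adjoint is the transpose. *)
Definition is_mpinv (R : realType) m n (A : 'M[R]_(m, n)) (X : 'M[R]_(n, m)) :
    Prop :=
  [/\ A *m X *m A = A, X *m A *m X = X,
      (A *m X)^T = A *m X & (X *m A)^T = X *m A].

(* The unique solution of the Penrose equations: see [mpinvP], [mpinv_uniq]. *)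
Definition mpinv (R : realType) m n (A : 'M[R]_(m, n)) : 'M[R]_(n, m) :=
  xget 0 (is_mpinv A).

Lemma mulmx_tr_eq0 (R : realType) m n (A : 'M[R]_(m, n)) :
  A *m A^T = 0 -> A = 0.
Proof.
move=> AA0; apply/matrixP => i j; rewrite mxE; apply/eqP.
move/matrixP: AA0 => /(_ i i); rewrite !mxE => /eqP.
rewrite psumr_eq0 => [/allP /(_ j)|k _]; last by rewrite mxE -expr2 sqr_ge0.
by rewrite mem_index_enum mxE -expr2 sqrf_eq0 => /(_ isT).
Qed.

Lemma gram_unit (R : realType) m n (A : 'M[R]_(m, n)) :
  row_free A -> A *m A^T \in unitmx.
Proof.
move=> Afree; rewrite -row_free_unit -kermx_eq0; apply/eqP.
have uA0 : kermx (A *m A^T) *m A = 0.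
  apply: mulmx_tr_eq0; rewrite trmx_mul !mulmxA.
  by rewrite -(mulmxA _ A) mulmx_ker mul0mx.
by apply: (row_free_inj Afree); rewrite mul0mx.
Qed.

Lemma is_mpinv_full_rank (R : realType) m n r (C : 'M[R]_(m, r))
    (F : 'M[R]_(r, n)) :
  row_full C -> row_free F -> exists X, is_mpinv (C *m F) X.
Proof.
move=> Cfull Ffree.
have FU : F *m F^T \in unitmx by apply: gram_unit.
have CU : C^T *m C \in unitmx.
  by rewrite -{2}[C]trmxK; apply: gram_unit; rewrite /row_free mxrank_tr.
pose P := invmx (F *m F^T); pose Q := invmx (C^T *m C).
have PT : P^T = P by rewrite /P trmx_inv trmx_mul trmxK.
have QT : Q^T = Q by rewrite /Q trmx_inv trmx_mul trmxK.
pose X := F^T *m P *m Q *m C^T.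
have AX : C *m F *m X = C *m Q *m C^T.
  rewrite /X !mulmxA -(mulmxA C F) -(mulmxA C (F *m _)).
  by rewrite mulmxV // mulmx1.
have XA : X *m (C *m F) = F^T *m P *m F.
  rewrite /X !mulmxA -(mulmxA _ C^T C) -(mulmxA _ Q).
  by rewrite mulVmx // mulmx1.
exists X; split.
- rewrite AX !mulmxA -(mulmxA _ C^T C) -(mulmxA _ Q).
  by rewrite mulVmx // mulmx1.
- rewrite XA /X !mulmxA -(mulmxA _ F F^T) -(mulmxA _ P (F *m _)).
  by rewrite mulVmx // mulmx1.
- by rewrite AX !trmx_mul trmxK QT mulmxA.
- by rewrite XA !trmx_mul trmxK PT mulmxA.
Qed.

Lemma mpinvP (R : realType) m n (A : 'M[R]_(m, n)) : is_mpinv A (mpinv A).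
Proof.
apply: xgetPex; rewrite -[A]mulmx_base.
by apply: is_mpinv_full_rank; [exact: col_base_full | exact: row_base_free].
Qed.

Lemma mpinv_uniq (R : realType) m n (A : 'M[R]_(m, n)) (X : 'M[R]_(n, m)) :
  is_mpinv A X -> X = mpinv A.
Proof.
move: (mpinv A) (mpinvP A) => Y [Y1 Y2 Y3 Y4] [X1 X2 X3 X4].
have AXY : A *m X = A *m Y.
  rewrite -X3 trmx_mul -{1}Y1 !trmx_mul mulmxA -trmx_mul X3.
  by rewrite -[Y^T *m _]trmx_mul Y3 mulmxA X1.
have XAY : X *m A = Y *m A.
  rewrite -X4 trmx_mul -{1}Y1 -mulmxA trmx_mul -mulmxA -[A^T *m X^T]trmx_mul X4.
  by rewrite Y4 -mulmxA (mulmxA A) X1.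
by rewrite -X2 XAY -mulmxA AXY mulmxA Y2.
Qed.

Lemma card_setC_eq N (S K : {set 'I_N}) :
  #|S| = #|K| -> #|(~: S)%SET| = #|(~: K)%SET|.
Proof.
by move=> eSK; apply/(@addnI #|S|); rewrite {2}eSK !cardsC.
Qed.

(* [enum_val] lists the complements of S and K in increasing order; the     *)
(* successors in the sign make the indices 1-based.                          *)
Definition submx_cofactor (R : realType) N (A : 'M[R]_N) (S K : {set 'I_N})
    (eSK : #|S| = #|K|) : R :=
  (-1) ^+ (\sum_(a in S) a.+1 + \sum_(b in K) b.+1)%N *
  \det (\matrix_(a < #|(~: S)%SET|, b < #|(~: S)%SET|)
          A (enum_val a) (enum_val (cast_ord (card_setC_eq eSK) b))).

Section BlockIndices.
Variables n s : nat.

(* [\mxblock_(i < n, j < n) _] with constant block size s has dimension      *)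
(* [\sum_(i < n) s] (that is, n * s); position k of block i is index         *)
(* [tagnat.Rank i k], whose value is i * s + k.                              *)
Definition block_idx (i : 'I_n) : {set 'I_(\sum_(i < n) s)} :=
  [set tagnat.Rank (p_ := fun=> s) i k | k : 'I_s].

Lemma block_idx_interval (i : 'I_n) (a : 'I_(\sum_(i < n) s)) :
  (a \in block_idx i) = (i * s <= a < i.+1 * s)%N.
Proof.
have RankE j k : tagnat.Rank (p_ := fun=> s) j k = (j * s + k)%N :> nat.
  rewrite tagnat.RankEsum (big_ord_narrow (ltnW (ltn_ord j))) /=.
  by rewrite sum_nat_const card_ord.
apply/imsetP/idP => [[k _ ->]|/andP[lea lta]].
  by rewrite RankE leq_addr mulSn addnC ltn_add2r ltn_ord.
have lts : (a - i * s < s)%N by rewrite ltn_subLR // addnC -mulSn.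
by exists (Ordinal lts) => //; apply/ord_inj; rewrite RankE /= subnKC.
Qed.

Lemma card_block_idx (i : 'I_n) : #|block_idx i| = s.
Proof.
rewrite card_imset ?card_ord // => k l kl; apply/val_inj/eqP.
have /eqP := congr1 val kl.
by rewrite tagnat.eq_Rank eqxx.
Qed.

Lemma card_block_idx_eq (i j : 'I_n) : #|block_idx i| = #|block_idx j|.
Proof. by rewrite !card_block_idx. Qed.

End BlockIndices.

Definition block_cofactor (R : realType) n s (A : 'M[R]_(\sum_(i < n) s))
    (i j : 'I_n) : R :=
  submx_cofactor A (card_block_idx_eq s i j).

Section MatrixWeightedGraph.
Variables (R : realType) (n s : nat).
Variables (e : rel 'I_n) (W : 'I_n -> 'I_n -> 'M[R]_s).

Definition laplacian : 'M[R]_(\sum_(i < n) s) :=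
  \mxblock_(i < n, j < n)
    (if i == j then \sum_(k | e i k) invmx (W i k)
     else if e i j then - invmx (W i j) else 0).

Definition resistance_block (i j : 'I_n) : 'M[R]_s :=
  let K := submxblock (mpinv laplacian) in K i i + K j j - 2 *: K i j.

Definition resistance : 'M[R]_(\sum_(i < n) s) :=
  \mxblock_(i < n, j < n) resistance_block i j.

Definition tau : 'M[R]_(\sum_(i < n) s, s) :=
  \mxcol_(i < n)
    (2%:M - \sum_(j | e i j) invmx (W i j) *m resistance_block j i).

End MatrixWeightedGraph.

(* Main.v *)
(* Write U for the block column of n identity blocks, so that LU = 0 and        *)
(* U'U = n.  From R = DU' + UD' - 2 L^+, with D the block column of the         *)
(* diagonal blocks of L^+, one gets LR = tau U' - 2 and U' tau = 2.  Hence      *)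
(* L(R tau) = 0, so R tau = UX for some X, and                                  *)
(*   R (L - 2 tau tau') = -2 (1 + U (X - 1/2) tau'),                            *)
(* where the right-hand determinant is (-2)^(ns) det (tau' R tau) because       *)
(* tau' U = 2 and tau' R tau = 2X.  On the left, the identity                   *)
(*   n^(2s) det (L + AB') = det (U'A) det (B'U) det (L + UU')                   *)
(* evaluates det (L - 2 tau tau') and, with A and B the i-th and j-th           *)
(* block columns of the identity, also the (i, j) block cofactor of L.          *)
Require Import Defs.
From mathcomp Require Import all_boot all_order all_fingroup all_algebra.
From mathcomp Require Import zify ring.
From mathcomp Require Import reals.

Set Implicit Arguments.
Unset Strict Implicit.
Unset Printing Implicit Defensive.

Import Order.TTheory GRing.Theory Num.Theory.

Local Open Scope ring_scope.

(** Positive definite weights on a connected graph force the kernel of L to be the span of U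
    ([laplacian_ker_const]), so [L + U *m U^T] is invertible ([laplacian_ones_unit]). Every update L
    + AB' with A and B of s columns then has a determinant that is an explicit multiple of det (L +
    UU') ([det_rank_update]).

    Two such updates matter. With unit block columns the update computes a block cofactor
    ([block_cofactorE]), which is therefore the same for all blocks and nonzero. With A = -2 tau and
    B = tau it gives det (L - 2 tau tau') = (-8)^s chi. The relations of R and tau with L ([tauE],
    [laplacian_resistance], [ones_tau]) allow det (R (L - 2 tau tau')) to be computed a second way,
    and [det_resistance_abstract] compares the two values.

    The signed minor in the definition of a cofactor is turned into a full determinant by
    [det_unit_rows], which rests on the sign of a shuffle ([odd_shuffle]). *)

(** * Signs of shuffles, and cofactors as full determinants *)

(** Strict growth gives x <= f x by induction from the bottom and f x <= x by induction from the
    top. *)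
Lemma ord_homo_id N (f : 'I_N -> 'I_N) :
  (forall x y : 'I_N, (x < y)%N -> (f x < f y)%N) -> f =1 id.
Proof.
move=> f_homo; have lef m (x : 'I_N) : x = m :> nat -> (m <= f x)%N.
  elim: m x => [//|m IHm] x xm.
  have ltmN : (m < N)%N by have := ltn_ord x; lia.
  apply: leq_ltn_trans (IHm (Ordinal ltmN) erefl) (f_homo _ _ _).
  by rewrite /= xm.
have gef m (x : 'I_N) : (N - x)%N = m -> (f x <= x)%N.
  elim: m x => [|m IHm] x xm; first by have := ltn_ord x; lia.
  have [lt1|ge1] := ltnP x.+1 N; last by have := ltn_ord (f x); lia.
  have := f_homo x (Ordinal lt1) (leqnn _).
  have : (N - x.+1 = m)%N by lia.
  by move=> /(IHm (Ordinal lt1)) /=; lia.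
by move=> x; apply/val_inj/eqP; rewrite eqn_leq (gef _ x erefl) (lef _ x erefl).
Qed.

(** Deleting i and its image leaves a permutation of one point fewer; this drives the induction on
    the sign of a shuffle. *)
Lemma perm_lift_perm N (s : 'S_N.+1) (i : 'I_N.+1) :
  exists t : 'S_N, s = lift_perm i (s i) t.
Proof.
pose f k := odflt k (unlift (s i) (s (lift i k))).
have fK k : lift (s i) (f k) = s (lift i k).
  rewrite /f; have := neq_lift i k; rewrite -(inj_eq (@perm_inj _ s)).
  by case/unlift_some => ? ? ->.
have f_inj : injective f.
  by move=> x y fxy; apply/(@lift_inj _ i)/(@perm_inj _ s); rewrite -!fK fxy.
exists (perm f_inj); apply/permP => k.
case: (unliftP i k) => [k'|] ->; rewrite ?lift_perm_id //.
by rewrite lift_perm_lift permE fK.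
Qed.

(* The inversions of a shuffle [s] are counted by [\sum_(x < k) (s x - x)].   *)
Lemma odd_shuffle N k (s : 'S_N) :
  (k <= N)%N ->
  (forall x y : 'I_N, (x < y)%N -> (y < k)%N || (k <= x)%N -> (s x < s y)%N) ->
  odd_perm s = odd (\sum_(x < N | (x < k)%N) s x + 'C(k, 2)).
Proof.
elim: k N s => [|k IHk] N s.
  move=> _ s_homo; rewrite big_pred0 //.
  suff -> : s = 1%g by rewrite odd_perm1.
  by apply/permP => x; rewrite perm1 ord_homo_id // => y z yz; apply: s_homo.
case: N s => [//|N] s; rewrite ltnS => lekN s_homo.
have [t st] := perm_lift_perm s ord0; set j := s ord0 in st.
have sl x : s (lift ord0 x) = lift j (t x) by rewrite st lift_perm_lift.
have t_homo (x y : 'I_N) : (x < y)%N -> (y < k)%N || (k <= x)%N -> (t x < t y)%N.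
  move=> xy xyk; have := s_homo (lift ord0 x) (lift ord0 y).
  rewrite !sl /= /bump !leq0n !add1n !ltnS => /(_ xy xyk).
  by rewrite ltnNge leq_bump2 -ltnNge.
rewrite st odd_lift_perm (IHk N t lekN t_homo) /= -st.
rewrite [in RHS]big_mkcond big_ord_recl /= -big_mkcond /=.
(* The k later values of the first run exceed j = s 0, so each of them drops by exactly one when j
   is deleted. The total k is the difference between ['C(k.+1, 2)] and ['C(k, 2)]. *)
have -> : (\sum_(i < N | (bump 0 i < k.+1)%N) s (lift ord0 i) =
   \sum_(i < N | (i < k)%N) t i + k)%N.
  have {3}-> : k = (\sum_(i < N | (i < k)%N) 1)%N.
    by rewrite (big_ord_narrow lekN) sum1_card card_ord.
  rewrite -big_split /=; apply: eq_big => [i|i]; rewrite /bump leq0n //= => ik.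
  have := s_homo ord0 (lift ord0 i) (ltn0Sn _).
  by rewrite /= ik => /(_ isT); rewrite -/j sl /= /bump; lia.
rewrite binS bin1 !oddD /=.
by case: (odd _) (odd _) (odd _) (odd _) => [] [] [] [].
Qed.


(** Laplace expansion along k unit rows: moving the rows f and the columns g to the front by two
    shuffles leaves a lower block triangular matrix with an identity corner. *)
Lemma det_unit_rows (R : comPzRingType) k m N (eN : (k + m)%N = N) (A : 'M[R]_N)
    (f g : 'I_k -> 'I_N) (f' g' : 'I_m -> 'I_N) :
  {homo f : x y / (x < y)%N} -> {homo g : x y / (x < y)%N} ->
  {homo f' : x y / (x < y)%N} -> {homo g' : x y / (x < y)%N} ->
  (forall x y, f x != f' y) -> (forall x y, g x != g' y) ->
  (forall x j, A (f x) j = (j == g x)%:R) ->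
  \det A = (-1) ^+ (\sum_(x < k) (f x).+1 + \sum_(x < k) (g x).+1)%N *
           \det (\matrix_(x < m, y < m) A (f' x) (g' y)).
Proof.
have homo_inj p q (h : 'I_p -> 'I_q) :
    {homo h : x y / (x < y)%N} -> injective h.
  move=> h_homo x y hxy; apply/val_inj.
  by case: (ltngtP x y) => // /h_homo; rewrite hxy ltnn.
have glue (h : 'I_k -> 'I_N) (h' : 'I_m -> 'I_N) :
    {homo h : x y / (x < y)%N} -> {homo h' : x y / (x < y)%N} ->
    (forall x y, h x != h' y) ->
    exists s : 'S_N,
      [/\ forall x, s (cast_ord eN (lshift m x)) = h x,
          forall x, s (cast_ord eN (rshift k x)) = h' x &
          odd_perm s = odd (\sum_(x < k) h x + 'C(k, 2))].
  subst N => h_homo h'_homo hh'.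
  pose s0 z := match split z with inl x => h x | inr x => h' x end.
  have s0l x : s0 (lshift m x) = h x by rewrite /s0 (unsplitK (inl _ x)).
  have s0r x : s0 (rshift k x) = h' x by rewrite /s0 (unsplitK (inr _ x)).
  have s0_inj : injective s0.
    move=> x y; case: (split_ordP x) => {}x ->; case: (split_ordP y) => {}y ->.
    - by rewrite !s0l => /(homo_inj _ _ _ h_homo) ->.
    - by rewrite s0l s0r => /eqP; rewrite (negPf (hh' _ _)).
    - by rewrite s0l s0r => /eqP; rewrite eq_sym (negPf (hh' _ _)).
    - by rewrite !s0r => /(homo_inj _ _ _ h'_homo) ->.
  exists (perm s0_inj); split=> [x|x|].
  - by rewrite permE cast_ord_id s0l.
  - by rewrite permE cast_ord_id s0r.
  rewrite (@odd_shuffle _ k) ?leq_addr //; last first.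
    move=> x y; rewrite !permE.
    case: (split_ordP x) => {}x ->; case: (split_ordP y) => {}y ->;
      rewrite ?s0l ?s0r /=.
    - by move=> xy _; apply: h_homo.
    - by move=> _; have := ltn_ord x; lia.
    - by have := ltn_ord y; lia.
    - by rewrite ltn_add2l => xy _; apply: h'_homo.
  congr (odd (_ + _)).
  rewrite (big_ord_narrow (leq_addr m k)); apply: eq_bigr => x _.
  by rewrite permE -s0l; congr (val (s0 _)); apply/val_inj.
move=> f_homo g_homo f'_homo g'_homo ff' gg' Af.
have [s [sl sr s_odd]] := glue f f' f_homo f'_homo ff'.
have [t [tl tr t_odd]] := glue g g' g_homo g'_homo gg'.
have -> : \det A = (-1) ^+ s * (-1) ^+ t * \det (row_perm s (col_perm t A)).
  rewrite row_permE col_permE !det_mulmx !det_perm odd_permV.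
  rewrite [\det A * _]mulrC mulrACA -expr2 sqrr_sign mul1r.
  by rewrite mulrA -expr2 sqrr_sign mul1r.
congr (_ * _).
  (* Modulo 2, the two terms ['C(k, 2)] cancel, and so do the two shifts by k that come from 1-based
     indices. *)
  rewrite -signr_addb -[RHS]signr_odd s_odd t_odd.
  have sumS (h : 'I_k -> 'I_N) : (\sum_(x < k) (h x).+1 = \sum_(x < k) h x + k)%N.
    under eq_bigr do rewrite -addn1.
    by rewrite big_split /= sum1_card card_ord.
  rewrite !sumS !oddD; congr (_ ^+ _); congr nat_of_bool.
  by case: (odd _) (odd _) (odd _) (odd _) => [] [] [] [].
subst N.
transitivity (\det (block_mx 1%:M 0 (\matrix_(x < m, y < k) A (f' x) (g y))
    (\matrix_(x < m, y < m) A (f' x) (g' y)))); last first.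
  by rewrite det_lblock det1 mul1r.
congr (\det _); apply/matrixP => x y; rewrite [LHS]mxE mxE.
case: (split_ordP x) => {}x ->; case: (split_ordP y) => {}y ->;
  rewrite ?(block_mxEul, block_mxEur, block_mxEdl, block_mxEdr) !mxE
    -?(sl, sr, tl, tr) ?cast_ord_id //.
- have -> : s (lshift m x) = f x by rewrite -sl cast_ord_id.
  have -> : t (lshift m y) = g y by rewrite -tl cast_ord_id.
  by rewrite Af (inj_eq (homo_inj _ _ _ g_homo)) eq_sym.
- have -> : s (lshift m x) = f x by rewrite -sl cast_ord_id.
  have -> : t (rshift k y) = g' y by rewrite -tr cast_ord_id.
  by rewrite Af eq_sym (negPf (gg' _ _)).
Qed.

Lemma sorted_enum_ord_set N (S : {set 'I_N}) :
  sorted (fun a b : 'I_N => (a < b)%N) (enum S).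
Proof.
have : sorted ltn (map val (enum S)).
  rewrite (subseq_sorted ltn_trans (map_subseq _ (filter_subseq _ _))) //.
  by rewrite -enumT val_enum_ord iota_ltn_sorted.
by rewrite sorted_map.
Qed.

Lemma enum_val_homo N (S : {set 'I_N}) :
  {homo (@enum_val _ (mem S)) : x y / (x < y)%N}.
Proof.
move=> x y xy.
have lty : (y < size (enum S))%N by rewrite -cardE.
have x0 := enum_val x; rewrite !(enum_val_nth x0).
apply: (sorted_ltn_nth (leT := fun a b : 'I_N => (a < b)%N)) => //.
- by move=> a b c; apply: ltn_trans.
- exact: sorted_enum_ord_set.
- by rewrite inE (ltn_trans xy).
Qed.

(** B keeps the rows of A outside S and has, in the rows of S, the unit vectors at the columns of K
    in increasing order; expanding along these rows yields the minor with its sign. *)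
Lemma submx_cofactor_unit_rows (R : realType) N (A B : 'M[R]_N)
    (S K : {set 'I_N}) (eSK : #|S| = #|K|) :
  (forall x j, B (enum_val x) j = (j == enum_val (cast_ord eSK x))%:R) ->
  (forall i j, i \notin S -> B i j = A i j) ->
  submx_cofactor A eSK = \det B.
Proof.
move=> BS BA.
have enum_valC (T : {set 'I_N}) x (y : 'I_#|(~: T)%SET|) :
    @enum_val _ (mem T) x != enum_val y.
  by apply: contraTneq (enum_valP y) => <-; rewrite inE negbK enum_valP.
have eN : (#|S| + #|(~: S)%SET| = N)%N by rewrite cardsC card_ord.
rewrite (@det_unit_rows _ #|S| #|(~: S)%SET| _ eN B
  enum_val (fun x => enum_val (cast_ord eSK x))
  enum_val (fun x => enum_val (cast_ord (card_setC_eq eSK) x))) //.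
- congr (_ * _).
    rewrite (big_enum_val (A := mem S)) (big_enum_val (A := mem K)).
    congr (_ ^+ (_ + _)).
    rewrite (reindex (cast_ord eSK)) //.
    by exists (cast_ord (esym eSK)) => x _; rewrite (cast_ordK, cast_ordKV).
  congr (\det _); apply/matrixP => x y; rewrite !mxE BA //.
  by have := enum_valP x; rewrite inE.
- exact: enum_val_homo.
- by move=> x y xy; apply: enum_val_homo.
- exact: enum_val_homo.
- by move=> x y xy; apply: enum_val_homo.
- by move=> x y; apply: enum_valC.
- by move=> x y; apply: enum_valC.
Qed.

(** * Low-rank updates of a matrix with known kernel *)

(** Sylvester's identity: both sides are the determinant of [block_mx 1%:M (- A) B 1%:M], factored
    in two ways. *)
Lemma det_1Dmul_comm (R : comPzRingType) m n (A : 'M[R]_(m, n)) (B : 'M[R]_(n, m)) :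
  \det (1%:M + A *m B) = \det (1%:M + B *m A).
Proof.
have : block_mx 1%:M (- A) 0 1%:M *m block_mx (1%:M + A *m B) 0 B 1%:M =
       block_mx 1%:M 0 B 1%:M *m block_mx 1%:M (- A) 0 (1%:M + B *m A).
  rewrite !mulmx_block !mul1mx !mul0mx !mulmx1 ?mulmx0 ?addr0 ?add0r mulNmx mulmxN.
  by rewrite addrK [1%:M + B *m A]addrC addKr.
move/(congr1 determinant); rewrite !det_mulmx !det_ublock !det_lblock !det1.
by rewrite !mul1r !mulr1.
Qed.

Lemma tr_mpinv (R : realType) m n (A : 'M[R]_(m, n)) : (mpinv A)^T = mpinv A^T.
Proof.
apply: mpinv_uniq; have [AXA XAX AXT XAT] := mpinvP A.
by split; rewrite -!trmx_mul ?mulmxA ?AXA ?XAX ?AXT ?XAT.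
Qed.

Section KernelComplement.
Variables (F : fieldType) (N s : nat) (L : 'M[F]_N) (U : 'M[F]_(N, s)) (c : F).
Hypotheses (c_neq0 : c != 0) (LU : L *m U = 0) (UL : U^T *m L = 0).
Hypothesis UU : U^T *m U = c%:M.

(** A and then B^T are traded for U and U^T. Since U^T L = 0, L U = 0 and U^T U = c, each trade
    splits off a factor 1 + (rank at most s), whose determinant Sylvester's identity reduces to size
    s, at the cost of c^s. *)
Lemma det_rank_update (A B : 'M[F]_(N, s)) :
  c ^+ (2 * s) * \det (L + A *m B^T) =
  \det (U^T *m A) * \det (B^T *m U) * \det (L + U *m U^T).
Proof.
have scaleK (X : 'M[F]_s) : c ^+ s * \det (1%:M + c^-1 *: (X - c%:M)) = \det X.
  rewrite -detZ scalerDr scalerA divff // scale1r scale_scalar_mx mulr1.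
  by rewrite addrC subrK.
have left : c ^+ s * \det (L + A *m B^T) = \det (U^T *m A) * \det (L + U *m B^T).
  have -> : L + A *m B^T = (1%:M + (c^-1 *: (A - U)) *m U^T) *m (L + U *m B^T).
    rewrite mulmxDl mul1mx mulmxDr -[_ *m U^T *m L]mulmxA UL mulmx0 add0r.
    rewrite -!mulmxA (mulmxA U^T) UU mul_scalar_mx -scalemxAr -scalemxAl scalerA.
    by rewrite divff // scale1r mulmxBl -addrA [U *m _ + _]addrC subrK.
  rewrite det_mulmx det_1Dmul_comm -scalemxAr mulmxBr UU mulrA.
  by rewrite scaleK.
have right : c ^+ s * \det (L + U *m B^T) = \det (B^T *m U) * \det (L + U *m U^T).
  have -> : L + U *m B^T = (L + U *m U^T) *m (1%:M + U *m (c^-1 *: (B^T - U^T))).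
    rewrite mulmxDr mulmx1 mulmxDl mulmxA LU mul0mx add0r.
    rewrite -!mulmxA (mulmxA U^T) UU mul_scalar_mx scalerA.
    by rewrite divff // scale1r mulmxBr -addrA [U *m U^T + _]addrC subrK.
  rewrite det_mulmx det_1Dmul_comm -scalemxAl mulmxBl UU mulrCA mulrC.
  by rewrite scaleK.
by rewrite mul2n -addnn exprD -mulrA left mulrCA right mulrA.
Qed.

Hypothesis G_unit : L + U *m U^T \in unitmx.

(** The invertible matrix L + U U^T sends both sides to U U^T Y. *)
Lemma kernel_span p (Y : 'M[F]_(N, p)) :
  L *m Y = 0 -> Y = U *m (c^-1 *: (U^T *m Y)).
Proof.
move=> LY; apply: (can_inj (mulKmx G_unit)).
rewrite !mulmxDl LY add0r mulmxA LU mul0mx add0r.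
rewrite -!mulmxA (mulmxA U^T) UU mul_scalar_mx scalerA divff //.
by rewrite scale1r.
Qed.


(** L kills 1 - K L, so [kernel_span] applies to it; and U^T (1 - K L) = U^T, because K L = L K and
    U^T L = 0. *)
Lemma mulmx_pinv_span (K : 'M[F]_N) :
  L *m K *m L = L -> L *m K = K *m L -> L *m K = 1%:M - c^-1 *: (U *m U^T).
Proof.
move=> LKL LK; have /kernel_span : L *m (1%:M - K *m L) = 0.
  by rewrite mulmxBr mulmx1 mulmxA LKL subrr.
rewrite LK mulmxBr -LK mulmxA UL mul0mx subr0 mulmx1 -scalemxAr => <-.
by rewrite LK opprB addrC subrK.
Qed.

(** The determinant of Res (L - 2 t t^T) is evaluated once as a product, through [det_rank_update],
    and once through Sylvester's identity. *)
Lemma det_resistance_abstract (Res : 'M[F]_N) (t : 'M[F]_(N, s)) :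
  (2 : F) != 0 -> L^T = L -> Res^T = Res ->
  L *m Res = t *m U^T - 2%:M -> U^T *m t = 2%:M ->
  c ^+ (2 * s) * (- 2) ^+ N * \det (t^T *m Res *m t) =
  (- 8) ^+ s * \det (L + U *m U^T) * \det Res.
Proof.
move=> nz2 LT ResT LRes Ut.
have tU : t^T *m U = 2%:M by rewrite -[U]trmxK -trmx_mul Ut tr_scalar_mx.
have ResL : Res *m L = U *m t^T - 2%:M.
  by rewrite -[LHS]trmxK trmx_mul LT ResT LRes linearB /=
    trmx_mul trmxK tr_scalar_mx.
(* L Res t = t (U^T t) - 2 t = 0, so the columns of Res t lie in the kernel of L. *)
have [X ResX] : exists X, Res *m t = U *m X.
  exists (c^-1 *: (U^T *m (Res *m t))); apply: kernel_span.
  rewrite mulmxA LRes mulmxBl -mulmxA Ut.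
  by rewrite mul_mx_scalar mul_scalar_mx subrr.
have -> : \det (t^T *m Res *m t) = 2 ^+ s * \det X.
  by rewrite -mulmxA ResX mulmxA tU mul_scalar_mx detZ.
have : \det (Res *m (L + (- 2 *: t) *m t^T)) = (- 2) ^+ N * (2 ^+ s * \det X).
  have -> : Res *m (L + (- 2 *: t) *m t^T) =
            - 2 *: (1%:M + (U *m (X - 2^-1%:M)) *m t^T).
    rewrite [LHS]mulmxDr ResL mulmxA -scalemxAr ResX mulmxBr mulmxBl mul_mx_scalar.
    rewrite -!scalemxAl; move: (U *m t^T) (U *m X *m t^T) => P Q.
    by apply/matrixP => i j; rewrite !mxE; case: (i == j) => /=; field.
  rewrite detZ; congr (_ * _).
  (* The shift by 1/2 absorbs the identity: 1 + t^T U (X - 1/2) = 2 X. *)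
  rewrite -mulmxA det_1Dmul_comm -mulmxA tU mul_mx_scalar scalerBr.
  by rewrite scale_scalar_mx divff // addrC subrK detZ.
rewrite det_mulmx => resX; rewrite -[LHS]mulrA -resX.
rewrite mulrCA det_rank_update -scalemxAr detZ Ut tU !det_scalar.
(* U^T (-2 t) = -4 and t^T U = 2 contribute (-4)^s and 2^s. *)
have -> : - 8 = (- 2) * 2 * 2 :> F by ring.
by rewrite !exprMn; ring.
Qed.

End KernelComplement.

(** * Block columns and block cofactors *)

(** Both sides list the same set in strictly increasing order. *)
Lemma block_enum_val n s (i : 'I_n) (x : 'I_#|block_idx s i|) :
  enum_val x = tagnat.Rank (p_ := fun=> s) i (cast_ord (card_block_idx s i) x).
Proof.
have eqE : enum (block_idx s i) =
           [seq tagnat.Rank (p_ := fun=> s) i k | k <- enum 'I_s].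
  apply: (@irr_sorted_eq _ (fun a b : 'I_(\sum_(i < n) s) => (a < b)%N)).
  - by move=> a b c; apply: ltn_trans.
  - by move=> a; rewrite ltnn.
  - exact: sorted_enum_ord_set.
  - rewrite sorted_map.
    have : sorted ltn (map val (enum 'I_s)) by rewrite val_enum_ord iota_ltn_sorted.
    rewrite sorted_map; apply: sub_sorted => a b /= ab.
    by have := @tagnat.lt_Rank n (fun=> s) i a b; rewrite !ltEord => ->.
  - move=> a; rewrite mem_enum; apply/imsetP/mapP => -[k _ ->]; exists k => //.
    by rewrite mem_enum.
have k := cast_ord (card_block_idx s i) x.
have ltx : (x < s)%N := ltn_ord (cast_ord (card_block_idx s i) x).
rewrite (enum_val_nth (tagnat.Rank (p_ := fun=> s) i k)) eqE (nth_map k).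
  congr tagnat.Rank; apply/val_inj => /=.
  by rewrite nth_enum_ord.
by rewrite size_enum_ord.
Qed.

Section Blocks.
Variables (R : realType) (n s : nat).

Definition ones_mx : 'M[R]_(\sum_(i < n) s, s) := \mxcol_(i < n) 1%:M.

Definition unit_block (i : 'I_n) : 'M[R]_(\sum_(i < n) s, s) :=
  \mxcol_(k < n) (if k == i then 1%:M else 0 : 'M_s).

Lemma ones_mul p (X : 'I_n -> 'M[R]_(s, p)) :
  ones_mx^T *m \mxcol_i X i = \sum_i X i.
Proof.
rewrite tr_mxcol mul_mxrow_mxcol; apply: eq_bigr => i _.
by rewrite trmx1 mul1mx.
Qed.

Lemma unit_block_mul p (i : 'I_n) (X : 'I_n -> 'M[R]_(s, p)) :
  (unit_block i)^T *m \mxcol_i X i = X i.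
Proof.
rewrite tr_mxcol mul_mxrow_mxcol (bigD1 i) //= eqxx trmx1 mul1mx big1 ?addr0 //.
by move=> k /negPf ->; rewrite trmx0 mul0mx.
Qed.

Lemma ones_mul_ones : ones_mx^T *m ones_mx = n%:R%:M.
Proof.
by rewrite ones_mul sumr_const card_ord -scaler_nat scale_scalar_mx mulr1.
Qed.

Lemma unit_block_mul_ones i : (unit_block i)^T *m ones_mx = 1%:M.
Proof. by rewrite unit_block_mul. Qed.

Lemma ones_mul_unit_block i : ones_mx^T *m unit_block i = 1%:M.
Proof. by apply: trmx_inj; rewrite trmx_mul trmxK trmx1 unit_block_mul_ones. Qed.

Lemma unit_blockK i : (unit_block i)^T *m unit_block i = 1%:M.
Proof. by rewrite unit_block_mul eqxx. Qed.

Lemma unit_blockE i a k :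
  unit_block i a k = (a == tagnat.Rank (p_ := fun=> s) i k)%:R.
Proof.
have := tagnat.sig2K a; rewrite mxE.
move: (tagnat.sig1 a) (tagnat.sig2 a) => j l <-.
rewrite -[_ == _ in RHS](inj_eq val_inj) /= tagnat.eq_Rank.
by case: eqP; rewrite mxE.
Qed.

Lemma tr_unit_block_mulE p i (A : 'M[R]_(_, p)) k a :
  ((unit_block i)^T *m A) k a = A (tagnat.Rank (p_ := fun=> s) i k) a.
Proof.
rewrite mxE (bigD1 (tagnat.Rank (p_ := fun=> s) i k)) //= mxE unit_blockE eqxx.
rewrite mul1r [X in _ + X]big1 ?addr0 // => b /negPf bik.
by rewrite mxE unit_blockE bik mul0r.
Qed.

Lemma unit_block_mulE p i (A : 'M[R]_(_, p)) k a :
  (unit_block i *m A) (tagnat.Rank (p_ := fun=> s) i k) a = A k a.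
Proof. by rewrite -tr_unit_block_mulE mulmxA unit_blockK mul1mx. Qed.

(** The block rows of L sum to zero. Adding all other block rows of the updated matrix to the i-th
    therefore leaves there only the unit rows of block j, and [submx_cofactor_unit_rows] applies. *)
Lemma block_cofactorE (L : 'M[R]_(\sum_(i < n) s)) i j :
  ones_mx^T *m L = 0 ->
  block_cofactor L i j = \det (L + unit_block i *m (unit_block j)^T).
Proof.
move=> UL; pose E := unit_block.
(* Left multiplication by P adds all other block rows to block row i. *)
pose P := 1%:M + E i *m (ones_mx - E i)^T.
have detP : \det P = 1.
  rewrite /P det_1Dmul_comm linearB /= mulmxBl ones_mul_unit_block unit_blockK.
  by rewrite subrr addr0 det1.
have PL : P *m (L + E i *m (E j)^T) = L + E i *m ((E j)^T - (E i)^T *m L).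
  have UEL : (ones_mx - E i)^T *m (L + E i *m (E j)^T) = - ((E i)^T *m L).
    rewrite linearB /= mulmxBl !mulmxDr UL !mulmxA.
    rewrite ones_mul_unit_block unit_blockK mul1mx add0r opprD addrCA subrr.
    by rewrite addr0.
  by rewrite mulmxDl mul1mx -mulmxA UEL -addrA mulmxDr.
rewrite /block_cofactor -[RHS]mul1r -detP -det_mulmx -/(E i) PL.
apply: submx_cofactor_unit_rows => [x a|a b].
- rewrite !block_enum_val mxE unit_block_mulE [X in _ + X]mxE [X in _ + (_ + X)]mxE.
  rewrite tr_unit_block_mulE addrCA subrr addr0 mxE unit_blockE.
  by congr (_ == tagnat.Rank _ _)%:R; apply/val_inj.
- move=> aNi; rewrite mxE [X in _ + X]mxE [X in _ + X]big1 ?addr0 // => k _.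
  rewrite unit_blockE; case: eqP => [ak|_]; last by rewrite mul0r.
  by case/imsetP: aNi; exists k.
Qed.

End Blocks.

(** * Positive definite weights and the kernel of the Laplacian *)

Lemma posdef_unit (R : realType) s (A : 'M[R]_s) : posdef A -> A \in unitmx.
Proof.
move=> [AT A_gt0]; rewrite -row_free_unit; apply: inj_row_free => v vA.
apply/eqP/contraT => v_neq0; have := A_gt0 v^T.
by rewrite trmx_eq0 trmxK vA mul0mx mxE ltxx => /(_ v_neq0).
Qed.

Lemma posdef_inv (R : realType) s (A : 'M[R]_s) : posdef A -> posdef (invmx A).
Proof.
move=> Apos; have Au := posdef_unit Apos; have [AT A_gt0] := Apos.
split=> [|x x_neq0]; first by rewrite trmx_inv AT.
have := A_gt0 (invmx A *m x); rewrite trmx_mul trmx_inv AT.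
rewrite -!mulmxA mulKVmx // mulmxA; apply.
by apply: contraNneq x_neq0 => Ax; rewrite -(mulKVmx Au x) Ax mulmx0.
Qed.

Lemma posdef_ge0 (R : realType) s (A : 'M[R]_s) (x : 'cV_s) :
  posdef A -> 0 <= (x^T *m A *m x) 0 0.
Proof.
move=> [_ A_gt0]; have [->|/A_gt0/ltW //] := eqVneq x 0.
by rewrite mulmx0 mxE.
Qed.

Section Laplacian.
Variables (R : realType) (n s : nat) (e : rel 'I_n).
Variable W : 'I_n -> 'I_n -> 'M[R]_s.
Hypotheses (n_gt0 : (0 < n)%N) (e_sym : symmetric e) (e_irr : irreflexive e).
Hypothesis e_conn : forall i j : 'I_n, connect e i j.
Hypothesis W_sym : forall i j : 'I_n, e i j -> W i j = W j i.
Hypothesis W_pos : forall i j : 'I_n, e i j -> posdef (W i j).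

Local Notation L := (laplacian e W).
Local Notation U := (ones_mx R n s).

Let n_neq0 : n%:R != 0 :> R.
Proof. by rewrite pnatr_eq0 -lt0n. Qed.

Let V_sym i j : e i j -> (invmx (W i j))^T = invmx (W i j).
Proof. by move=> /W_pos/posdef_inv[]. Qed.

Lemma laplacian_mul p (X : 'I_n -> 'M[R]_(s, p)) :
  L *m \mxcol_i X i = \mxcol_i \sum_(j | e i j) invmx (W i j) *m (X i - X j).
Proof.
rewrite mul_mxblock_mxrow; apply: eq_mxcol => i.
rewrite (bigD1 i) //= eqxx mulmx_suml; under [RHS]eq_bigr do rewrite mulmxBr.
rewrite [RHS]sumrB; congr (_ + _).
rewrite -sumrN [RHS]big_mkcond [LHS]big_mkcond; apply: eq_bigr => j _ /=.
rewrite eq_sym; case: eqVneq => [->|_] /=; first by rewrite e_irr.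
by case: (e i j); rewrite ?mulNmx ?mul0mx.
Qed.

Lemma tr_laplacian : L^T = L.
Proof.
rewrite tr_mxblock; apply: eq_mxblock => i j; rewrite eq_sym.
case: eqVneq => [->|_].
  by rewrite linear_sum /=; apply: eq_bigr => k /V_sym.
rewrite e_sym; case: ifP => [eij|_]; last by rewrite trmx0.
by rewrite linearN /= -W_sym // V_sym.
Qed.

Lemma laplacian_ones : L *m U = 0.
Proof.
rewrite laplacian_mul -[RHS]mxcol0; apply: eq_mxcol => i.
by rewrite big1 // => j _; rewrite subrr mulmx0.
Qed.

Lemma ones_laplacian : U^T *m L = 0.
Proof. by rewrite -tr_laplacian -trmx_mul laplacian_ones trmx0. Qed.

(* The quadratic form of L is half the sum over the edges (i, j) of the       *)
(* values of the form of W i j ^-1 at x_i - x_j.                              *)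
Lemma laplacian_ker_const (X : 'I_n -> 'cV[R]_s) :
  L *m \mxcol_i X i = 0 -> forall i j, X i = X j.
Proof.
move=> LX.
pose Q i j : R :=
  if e i j then ((X i)^T *m (invmx (W i j) *m (X i - X j))) 0 0 else 0.
have Q0 : \sum_i \sum_j Q i j = 0.
  transitivity (((\mxcol_i X i)^T *m (L *m \mxcol_i X i)) 0 0); last first.
    by rewrite LX mulmx0 mxE.
  rewrite laplacian_mul tr_mxcol mul_mxrow_mxcol summxE; apply: eq_bigr => i _.
  by rewrite mulmx_sumr summxE [RHS]big_mkcond.
(* A single [Q i j] has no definite sign; together with the reversed edge it becomes a value of a
   positive definite form at X i - X j. *)
pose q i j := Q i j + Q j i.
have qE i j : e i j -> q i j = ((X i - X j)^T *m invmx (W i j) *m (X i - X j)) 0 0.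
  move=> eij; rewrite /q /Q eij e_sym eij -(W_sym eij).
  rewrite -[in RHS]mulmxA [(X i - X j)^T]linearB /= [in RHS]mulmxBl [RHS]mxE.
  congr (_ + _); rewrite -[X j - X i]opprB !mulmxN.
  by rewrite [LHS]mxE [RHS]mxE.
have q_ge0 i j : 0 <= q i j.
  have [eij|] := boolP (e i j).
    by rewrite qE //; apply/posdef_ge0/posdef_inv/W_pos.
  by rewrite /q /Q (e_sym j) => /negPf ->; rewrite addr0.
have q0 i j : q i j = 0.
  have : \sum_i \sum_j q i j = 0.
    under eq_bigr do rewrite big_split /=.
    by rewrite big_split /= Q0 exchange_big Q0 addr0.
  move/eqP; rewrite psumr_eq0 => [/allP/(_ i)|k _]; last exact: sumr_ge0.
  rewrite mem_index_enum => /(_ isT)/eqP/eqP.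
  rewrite psumr_eq0 // => /allP/(_ j).
  by rewrite mem_index_enum => /(_ isT)/eqP.
have edge i j : e i j -> X i = X j.
  move=> eij; apply/eqP; rewrite -subr_eq0; apply/contraT => Xij.
  have [_ /(_ _ Xij)] := posdef_inv (W_pos eij).
  by rewrite -qE // q0 ltxx.
move=> i j; have /connectP[p] := e_conn i j.
elim: p i => [|k p IHp] i /=; first by move=> _ ->.
by case/andP => /edge -> /IHp/[apply].
Qed.

(** If (L + UU') x = 0, applying U' gives n U'x = 0, hence Lx = 0. Then the blocks of x are all
    equal, and their sum U'x vanishes, so x = 0. *)
Lemma laplacian_ones_unit : L + U *m U^T \in unitmx.
Proof.
set G := L + _; have GT : G^T = G.
  by rewrite /G linearD /= tr_laplacian trmx_mul trmxK.
rewrite -row_free_unit; apply: inj_row_free => v vG.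
have Gv : G *m v^T = 0 by rewrite -[G]trmxK GT -trmx_mul vG trmx0.
have Uv : U^T *m v^T = 0.
  have : U^T *m (G *m v^T) = 0 by rewrite Gv mulmx0.
  rewrite mulmxA mulmxDr ones_laplacian add0r mulmxA ones_mul_ones mul_scalar_mx.
  by rewrite -scalemxAl => /eqP; rewrite scaler_eq0 (negPf n_neq0) => /eqP.
have Lv : L *m v^T = 0 by move: Gv; rewrite mulmxDl -mulmxA Uv mulmx0 addr0.
apply: trmx_inj; rewrite trmx0; move: Lv Uv; rewrite -[v^T]submxcolK.
move/laplacian_ker_const; set X := submxcol _ => Xc.
rewrite ones_mul => X0; rewrite -[RHS]mxcol0; apply: eq_mxcol => i.
have : \sum_(j < n) X j = n%:R *: X i.
  by rewrite scaler_nat -[in RHS](card_ord n) -sumr_const; apply: eq_bigr.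
by rewrite X0 => /esym/eqP; rewrite scaler_eq0 (negPf n_neq0) => /eqP.
Qed.

(** * The resistance matrix, tau and their relations with the Laplacian *)

Local Notation K := (mpinv L).
Local Notation Kdiag := (\mxcol_(i < n) submxblock K i i).

Lemma tr_pinv_laplacian : K^T = K.
Proof. by rewrite tr_mpinv tr_laplacian. Qed.

(** L and its pseudo-inverse are symmetric, so the symmetry of K L makes them commute; their product
    is the orthogonal projector off the span of U. *)
Lemma laplacian_pinv : L *m K = 1%:M - n%:R^-1 *: (U *m U^T).
Proof.
have [LKL _ _ KLT] := mpinvP L.
apply: (mulmx_pinv_span n_neq0 laplacian_ones ones_laplacian (ones_mul_ones _ _ _)
  laplacian_ones_unit LKL).
by rewrite -KLT trmx_mul tr_laplacian tr_pinv_laplacian.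
Qed.

Lemma resistanceE :
  resistance e W = Kdiag *m U^T + U *m Kdiag^T - 2 *: K.
Proof.
rewrite !tr_mxcol !mul_mxcol_mxrow.
apply/mxblockP => i j; rewrite submxblockB submxblockD !mxblockK.
rewrite trmx1 mulmx1 mul1mx tr_submxblock tr_pinv_laplacian.
by congr (_ - _); apply/matrixP => a b; rewrite !mxE.
Qed.

Lemma tr_resistance : (resistance e W)^T = resistance e W.
Proof.
rewrite resistanceE linearB linearD linearZ /= !trmx_mul !trmxK.
by rewrite tr_pinv_laplacian [X in X - _]addrC.
Qed.

(** Block i of tau equals 2 plus the (i, i) block of LR, and LR = L D U' + (2/n) UU' - 2 with D =
    [Kdiag]. *)
Lemma tauE : tau e W = L *m Kdiag + 2 / n%:R *: U.
Proof.
have LR : L *m resistance e W =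
    L *m Kdiag *m U^T + (2 / n%:R) *: (U *m U^T) - 2%:M.
  rewrite resistanceE mulmxBr mulmxDr !mulmxA laplacian_ones mul0mx addr0.
  rewrite -scalemxAr laplacian_pinv scalerBr scalerA scale_scalar_mx mulr1 opprB.
  by rewrite addrA.
rewrite -[LHS]submxcolK -[RHS]submxcolK; apply: eq_mxcol => i.
set Ei := unit_block R s i.
have subE p (A : 'M[R]_(_, p)) : submxcol A i = Ei^T *m A.
  by rewrite -[A in RHS]submxcolK unit_block_mul.
rewrite mxcolK [RHS]subE.
have -> : Ei^T *m (L *m Kdiag + (2 / n%:R) *: U) =
    2%:M + Ei^T *m (L *m resistance e W *m Ei).
  rewrite LR mulmxBl mulmxDl -scalemxAl -!mulmxA ones_mul_unit_block !mulmx1.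
  rewrite mulmxBr mul_scalar_mx -scalemxAr unit_blockK.
  by rewrite scale_scalar_mx mulr1 addrCA subrr addr0.
congr (_ + _); rewrite -mulmxA.
have -> : resistance e W *m Ei = \mxcol_j resistance_block e W j i.
  rewrite mul_mxblock_mxrow; apply: eq_mxcol => j.
  rewrite (bigD1 i) //= eqxx mulmx1 big1 ?addr0 // => k /negPf ->.
  by rewrite mulmx0.
rewrite laplacian_mul unit_block_mul -sumrN; apply: eq_bigr => j eij.
rewrite -mulmxN; congr (_ *m _).
(* The diagonal blocks of R vanish, so R_ii - R_ji reduces to -R_ji. *)
rewrite [resistance_block e W i i]/resistance_block /=.
by rewrite scaler_nat -mulr2n subrr sub0r.
Qed.

Lemma ones_tau : U^T *m tau e W = 2%:M.
Proof.
rewrite tauE mulmxDr mulmxA ones_laplacian mul0mx add0r -scalemxAr ones_mul_ones.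
by rewrite scale_scalar_mx divfK.
Qed.

Lemma laplacian_resistance : L *m resistance e W = tau e W *m U^T - 2%:M.
Proof.
rewrite tauE resistanceE mulmxBr mulmxDr mulmxDl !mulmxA laplacian_ones.
rewrite mul0mx addr0 -scalemxAr laplacian_pinv scalerBr scalerA scale_scalar_mx.
rewrite mulr1 opprB.
by rewrite -scalemxAl addrA.
Qed.

(** The products of U with unit block columns are identities, so both small determinants in
    [det_rank_update] are 1. The right-hand side is free of i and j, hence all block cofactors
    agree. *)
Lemma block_cofactor_laplacian i j :
  n%:R ^+ (2 * s) * block_cofactor L i j = \det (L + U *m U^T).
Proof.
rewrite block_cofactorE ?ones_laplacian //.
rewrite (det_rank_update n_neq0 laplacian_ones ones_laplacian
  (ones_mul_ones _ _ _)).
by rewrite ones_mul_unit_block unit_block_mul_ones !det1 !mul1r.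
Qed.

Lemma block_cofactor_laplacian_neq0 i j : block_cofactor L i j != 0.
Proof.
have := laplacian_ones_unit; rewrite unitmxE unitfE -(block_cofactor_laplacian i j).
by rewrite mulf_eq0 negb_or => /andP[].
Qed.

(** The division-free form of the theorem: the factor n^(2s) occurs on both sides of
    [det_resistance_abstract] and cancels. *)
Lemma det_resistance i j :
  (- 2) ^+ (n * s) * \det ((tau e W)^T *m resistance e W *m tau e W) =
  (- 8) ^+ s * block_cofactor L i j * \det (resistance e W).
Proof.
have := det_resistance_abstract n_neq0 laplacian_ones ones_laplacian (ones_mul_ones _ _ _)
  laplacian_ones_unit _ tr_laplacian tr_resistance laplacian_resistance ones_tau.
rewrite pnatr_eq0 => /(_ isT); rewrite -(block_cofactor_laplacian i j).
have sumE : (\sum_(k < n) s = n * s)%N by rewrite sum_nat_const card_ord.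
rewrite -mulrA -{1}sumE => detR.
apply: (mulfI (expf_neq0 (2 * s) n_neq0)).
by rewrite [LHS]detR; ring.
Qed.

End Laplacian.

(** The power of 2 has an integer exponent because n - 3 may be negative; the cofactor is asserted
    to be nonzero so that the quotient is a genuine one. *)
Theorem theorem4p1 (R : realType) (n s : nat) (n_gt0 : (0 < n)%N)
    (s_gt0 : (0 < s)%N) (e : rel 'I_n) (e_sym : symmetric e)
    (e_irr : irreflexive e) (e_conn : forall i j : 'I_n, connect e i j)
    (W : 'I_n -> 'I_n -> 'M[R]_s)
    (W_sym : forall i j : 'I_n, e i j -> W i j = W j i)
    (W_pos : forall i j : 'I_n, e i j -> posdef (W i j)) :
  let L := laplacian e W in
  let Res := resistance e W in
  let t := tau e W in
  (forall i j k l : 'I_n, block_cofactor L i j = block_cofactor L k l) /\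
  (forall i j : 'I_n,
    block_cofactor L i j != 0 /\
    \det Res = (-1) ^+ ((n - 1) * s)%N * 2 ^ ((n%:Z - 3) * s%:Z) *
               (\det (t^T *m Res *m t) / block_cofactor L i j)).
Proof.
move=> L Res t.
have n_neq0 : n%:R != 0 :> R by rewrite pnatr_eq0 -lt0n.
split=> [i j k l|i j].
  apply: (mulfI (expf_neq0 (2 * s) n_neq0)).
  by rewrite !block_cofactor_laplacian.
have chi_neq0 : block_cofactor L i j != 0 by apply: block_cofactor_laplacian_neq0.
split=> //; have := det_resistance n_gt0 e_sym e_irr e_conn W_sym W_pos i j.
rewrite -/L -/Res -/t => detR.
have two_neq0 : (2 : R) != 0 by rewrite pnatr_eq0.
have neg8_neq0 : (- 8 : R) ^+ s != 0 by rewrite expf_neq0 // oppr_eq0 pnatr_eq0.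
apply: (mulfI chi_neq0); rewrite mulrCA [X in _ = _ * X]mulrC divfK //.
apply: (mulfI neg8_neq0); rewrite mulrA -detR mulrA; congr (_ * _).
(* Taking (-8)^s out of (-2)^(ns) lowers the exponent of -1 by s and that of 2 by 3s. *)
have -> : (- 8 : R) = - 1 * 2 ^+ 3 by ring.
rewrite -[in LHS]mulN1r !exprMn mulrACA -!exprD; congr (_ ^+ _ * _).
  by rewrite -mulSn subn1 prednK.
rewrite !exprnP -expfzDr //; congr (2 ^ _).
by rewrite !PoszD PoszM; ring.
Qed.
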